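(* Let $\mathfrak{X}=(X,f,n)$ be a simply-connected face-edge-constraint net, let $\phi:F\to\mathbb{H}$ and let $\boldsymbol{\rho}:F\to\mathbb{R}$ be a real-valued function such that $D_f\phi=\boldsymbol{\rho}\,\phi$, i.e. $D_f(\phi)|_i=\boldsymbol{\rho}_i\phi_i$ for every face $\Delta_i$. Then the imaginary parts of the hyperedges $s_\phi(E_{ij})=\overline{\phi_i}\cdot E_{ij}\cdot\phi_j$ obtained by the spin transformation are closed around every face: for every face $\Delta_i$, $$\sum_j \mathrm{Im}\big(s_\phi(E_{ij})\big)=0,$$ where $j$ runs through all faces adjacent to $\Delta_i$.
   Context: $\mathbb{H}$ denotes the quaternions with units $\mathbf{i},\mathbf{j},\mathbf{k}$, and $\mathbb{R}^3$ is identified with $\mathrm{Im}(\mathbb{H})$. Oriented net: $X=(V,E,F)$ is a connected cell complex decomposing an oriented surface into polygonal faces (not necessarily planar after immersion); two adjacent faces share exactly one edge, and every edge is shared by exactly two faces. The edges of each face carry the boundary orientation of that face, so a common edge has opposite directions in its two faces. Given $f:V\to\mathbb{R}^3$ and adjacent faces $\Delta_i,\Delta_j$, $df_{ij}\in\mathrm{Im}(\mathbb{H})$ is the edge vector (head minus tail) of the common edge, oriented as in $\Delta_i$; so $df_{ij}=-df_{ji}$. Face-edge-constraint net: a triple $(X,f,n)$ with $f:V\to\mathbb{R}^3$ and $n:F\to\mathbb{S}^2$ such that $n_i+n_j\perp df_{ij}$ for all adjacent faces $\Delta_i,\Delta_j$. It is assumed that $df_{ij}\neq0$, that $n_i$ is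 not parallel to $df_{ij}$, and that all dihedral angles lie in $(-\pi,\pi)$, where the dihedral angle $\theta_{ij}$ is the angle of the right-handed rotation about $df_{ij}$ taking the half-plane $\mathbb{R}\,df_{ij}+\mathbb{R}_{>0}n_i$ to $\mathbb{R}\,df_{ij}+\mathbb{R}_{>0}n_j$. Integrated mean curvature: $\mathbf{H}_{ij}=\tfrac12|df_{ij}|\tan\tfrac{\theta_{ij}}2$ and $\mathbf{H}_i=\sum_j\mathbf{H}_{ij}$. Hyperedge: $E_{ij}=2\mathbf{H}_{ij}+df_{ij}\in\mathbb{H}$. Discrete extrinsic Dirac operator on functions $\phi:F\to\mathbb{H}$: $D_f(\phi)|_i=\tfrac12\sum_jE_{ij}\cdot(\phi_j-\phi_i)=\tfrac12\sum_jE_{ij}\phi_j-\mathbf{H}_i\phi_i$, with $j$ running through the faces adjacent to $\Delta_i$. *)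

(* Defs.v *)
From HB Require Import structures.
From mathcomp Require Import all_boot all_order all_algebra.
From mathcomp Require Import all_classical all_reals all_analysis.
From mathcomp Require Import ring.

Set Implicit Arguments.
Unset Strict Implicit.
Unset Printing Implicit Defensive.

Import Order.TTheory GRing.Theory Num.Theory.

Local Open Scope classical_set_scope.
Local Open Scope ring_scope.

Record quat (R : Type) : Type :=
  Quat { qre : R; qi : R; qj : R; qk : R }.

Definition quat_to_prod (R : Type) (q : quat R) : R * R * R * R :=
  (qre q, qi q, qj q, qk q).
Definition quat_of_prod (R : Type) (p : R * R * R * R) : quat R :=
  let: (a, b, c, d) := p in Quat a b c d.
Lemma quat_to_prodK (R : Type) : cancel (@quat_to_prod R) (@quat_of_prod R).
Proof. by case. Qed.

HB.instance Definition _ (R : choiceType) :=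
  Choice.copy (quat R) (can_type (@quat_to_prodK R)).

Section QuaternionAlgebra.
Context {R : realType}.
Implicit Types (p q r : quat R) (a b : R).

Definition qadd p q :=
  Quat (qre p + qre q) (qi p + qi q) (qj p + qj q) (qk p + qk q).
Definition qopp p := Quat (- qre p) (- qi p) (- qj p) (- qk p).
Definition qmul p q := Quat
  (qre p * qre q - qi p * qi q - qj p * qj q - qk p * qk q)
  (qre p * qi q + qi p * qre q + qj p * qk q - qk p * qj q)
  (qre p * qj q - qi p * qk q + qj p * qre q + qk p * qi q)
  (qre p * qk q + qi p * qj q - qj p * qi q + qk p * qre q).
Definition qscale a q := Quat (a * qre q) (a * qi q) (a * qj q) (a * qk q).

Lemma qaddA : associative qadd.
Proof. by move=> p q r; congr Quat; apply: addrA. Qed.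
Lemma qaddC : commutative qadd.
Proof. by move=> p q; congr Quat; apply: addrC. Qed.
Lemma qadd0 : left_id (Quat 0 0 0 0) qadd.
Proof. by case=> a b c d; congr Quat; apply: add0r. Qed.
Lemma qaddN : left_inverse (Quat 0 0 0 0) qopp qadd.
Proof. by case=> a b c d; congr Quat; apply: addNr. Qed.
HB.instance Definition _ :=
  GRing.isZmodule.Build (quat R) qaddA qaddC qadd0 qaddN.

Lemma qmulA : associative qmul.
Proof. by move=> p q r; congr Quat => /=; ring. Qed.
Lemma qmul1 : left_id (Quat 1 0 0 0) qmul.
Proof. by case=> a b c d; congr Quat => /=; ring. Qed.
Lemma qmulr1 : right_id (Quat 1 0 0 0) qmul.
Proof. by case=> a b c d; congr Quat => /=; ring. Qed.
Lemma qmulDl : left_distributive qmul qadd.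
Proof. by move=> p q r; congr Quat => /=; ring. Qed.
Lemma qmulDr : right_distributive qmul qadd.
Proof. by move=> p q r; congr Quat => /=; ring. Qed.
Lemma qone_neq0 : Quat 1 0 0 0 != 0 :> quat R.
Proof. by apply/eqP => -[/eqP]; rewrite oner_eq0. Qed.
HB.instance Definition _ := GRing.Zmodule_isNzRing.Build (quat R)
  qmulA qmul1 qmulr1 qmulDl qmulDr qone_neq0.

Lemma qscaleA a b q : qscale a (qscale b q) = qscale (a * b) q.
Proof. by congr Quat; apply: mulrA. Qed.
Lemma qscale1 : left_id 1 qscale.
Proof. by case=> a b c d; congr Quat; apply: mul1r. Qed.
Lemma qscaleDr : right_distributive qscale +%R.
Proof. by move=> a p q; congr Quat; apply: mulrDr. Qed.
Lemma qscaleDl q : {morph qscale^~ q : a b / a + b}.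
Proof. by move=> a b; congr Quat; apply: mulrDl. Qed.
HB.instance Definition _ := GRing.Zmodule_isLmodule.Build R (quat R)
  qscaleA qscale1 qscaleDr qscaleDl.

Lemma qscaleAl a p q : a *: (p * q) = (a *: p) * q.
Proof. by congr Quat => /=; ring. Qed.
HB.instance Definition _ :=
  GRing.Lmodule_isLalgebra.Build R (quat R) qscaleAl.

Lemma qscaleAr a p q : a *: (p * q) = p * (a *: q).
Proof. by congr Quat => /=; ring. Qed.
HB.instance Definition _ :=
  GRing.Lalgebra_isAlgebra.Build R (quat R) qscaleAr.

Definition qconj q : quat R := Quat (qre q) (- qi q) (- qj q) (- qk q).
Definition qim q : quat R := Quat 0 (qi q) (qj q) (qk q).
(* The Euclidean space R^3 is the subspace of imaginary quaternions. *)
Definition imaginary q : Prop := qre q = 0.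
Definition qdot p q : R :=
  qre p * qre q + qi p * qi q + qj p * qj q + qk p * qk q.
Definition qnorm q : R := Num.sqrt (qdot q q).
(* The vector product when p and q are imaginary. *)
Definition qcross p q : quat R := qim (p * q).

(* Rodrigues' formula: right-handed rotation of R^3 by the angle t about the
   axis directed by the nonzero vector e. *)
Definition rotation (e : quat R) (t : R) (v : quat R) : quat R :=
  let u := (qnorm e)^-1 *: e in
  cos t *: v + sin t *: qcross u v + ((1 - cos t) * qdot u v) *: u.

Definition half_plane (e m : quat R) : set (quat R) :=
  [set v | exists a b : R, 0 < b /\ v = a *: e + b *: m].

End QuaternionAlgebra.

Fixpoint walk (V D : Type) (src tgt : D -> V) (x : V) (p : seq D) (y : V) :
    Prop :=
  if p is d :: p' then src d = x /\ walk src tgt (tgt d) p' y else x = y.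

(* An oriented net, presented by its oriented edges ("darts").
   - [flip] reverses an oriented edge;
   - [lface d] is the face whose boundary orientation induces the direction of
     [d], so the edge {d, flip d} is shared by [lface d] and [lface (flip d)];
   - [succ d] follows [d] along the oriented boundary of [lface d].
   The orbit axioms [lface_orbit] and [origin_orbit] say that the boundary of a
   face is one finite cycle of darts, and that the darts leaving a vertex form
   one finite cycle around it: the complex is a surface without boundary. The
   net itself may be infinite. *)
Record oriented_net : Type := OrientedNet {
  vertex : Type;
  face : choiceType;
  dart : Type;
  origin : dart -> vertex;
  lface : dart -> face;
  flip : dart -> dart;
  succ : dart -> dart;
  flipK : involutive flip;
  origin_succ : forall d, origin (succ d) = origin (flip d);
  lface_orbit : forall d e, lface d = lface e <-> exists m, iter m succ d = e;
  origin_orbit : forall d e,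
    origin d = origin e <-> exists m, iter m (fun x => succ (flip x)) d = e;
  lface_surj : forall i, exists d, lface d = i;
  origin_surj : forall v, exists d, origin d = v;
  (* faces have at least three sides *)
  succ_succ_neq : forall d, succ (succ d) <> d;
  (* every edge is shared by two distinct faces, and two adjacent faces share
     only one edge *)
  lface_flip_neq : forall d, lface (flip d) <> lface d;
  common_edge_uniq : forall d e,
    lface d = lface e -> lface (flip d) = lface (flip e) -> d = e;
  net_connected : forall v w, exists p : seq dart,
    walk origin (fun d => origin (flip d)) v p w
}.

Section Nets.
Context {X : oriented_net}.
Implicit Types (d : dart X) (x y v : vertex X) (p q r : seq (dart X)).
Implicit Types (i j : face X).

Definition target d : vertex X := origin (flip d).

Definition edge_path x p y : Prop := walk (@origin X) target x p y.

(* Homotopy of edge paths from x to y, generated by removing or inserting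
   spurs and boundaries of faces. *)
Inductive homotopic x y : seq (dart X) -> seq (dart X) -> Prop :=
| homotopic_refl p : homotopic x y p p
| homotopic_sym p q : homotopic x y p q -> homotopic x y q p
| homotopic_trans p q r :
    homotopic x y p q -> homotopic x y q r -> homotopic x y p r
| homotopic_spur p d q :
    edge_path x (p ++ [:: d, flip d & q]) y ->
    homotopic x y (p ++ [:: d, flip d & q]) (p ++ q)
| homotopic_face p d m q :
    iter m (@succ X) d = d ->
    edge_path x (p ++ traject (@succ X) d m ++ q) y ->
    homotopic x y (p ++ traject (@succ X) d m ++ q) (p ++ q).

Definition adjacent_faces i : set (face X) :=
  [set j | exists d, lface d = i /\ lface (flip d) = j].

End Nets.

Definition simply_connected (X : oriented_net) : Prop :=
  forall (x : vertex X) (p : seq (dart X)),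
    edge_path x p x -> homotopic x x p [::].

Section FaceEdgeConstraintNets.
Context {R : realType} {X : oriented_net}.
Context (f : vertex X -> quat R) (n : face X -> quat R).
Implicit Types (i j : face X).

(* The vector of the common edge of i and j, oriented as in i. It is unique if
   i and j are adjacent; the value 0 for faces which are not is never used. *)
Definition edge_vector i j : quat R :=
  xget 0 [set f (target d) - f (origin d) |
          d in [set d : dart X | lface d = i /\ lface (flip d) = j]].

Definition dihedral_angle i j : R :=
  xget 0 [set t | - pi < t <= pi /\
    rotation (edge_vector i j) t @` half_plane (edge_vector i j) (n i) =
    half_plane (edge_vector i j) (n j)].

Record face_edge_constraint_net : Prop := FaceEdgeConstraintNet {
  vertex_imaginary : forall v, imaginary (f v);
  normal_imaginary : forall i, imaginary (n i);
  normal_unit : forall i, qnorm (n i) = 1;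
  face_edge_constraint :
    forall i j, adjacent_faces i j -> qdot (n i + n j) (edge_vector i j) = 0;
  edge_neq0 : forall i j, adjacent_faces i j -> edge_vector i j != 0;
  normal_not_parallel :
    forall i j, adjacent_faces i j -> forall a : R, n i != a *: edge_vector i j;
  dihedral_angle_range :
    forall i j, adjacent_faces i j -> - pi < dihedral_angle i j < pi
}.

Definition mean_curvature i j : R :=
  2^-1 * qnorm (edge_vector i j) * tan (dihedral_angle i j / 2).

Definition hyperedge i j : quat R :=
  (2 * mean_curvature i j)%:A + edge_vector i j.

Definition dirac_operator (phi : face X -> quat R) i : quat R :=
  2^-1 *: \sum_(j \in adjacent_faces i) hyperedge i j * (phi j - phi i).

Definition spin_hyperedge (phi : face X -> quat R) i j : quat R :=
  qconj (phi i) * hyperedge i j * phi j.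

End FaceEdgeConstraintNets.

(* Main.v *)
Require Import Defs.
From HB Require Import structures.
From mathcomp Require Import all_boot all_order all_algebra.
From mathcomp Require Import all_classical all_reals all_analysis.
From mathcomp Require Import ring.

Import Order.TTheory GRing.Theory Num.Theory.
Local Open Scope classical_set_scope.
Local Open Scope ring_scope.

(** Multiply the eigenvalue equation at the face [i] on the left by
    [2 *: qconj (phi i)].  Its right-hand side becomes
    [2 * rho i * |phi i| ^ 2], a real number, while its left-hand side is the
    sum of the transformed hyperedges minus
    [qconj (phi i) * (\sum_j hyperedge i j) * phi i].  In the sum of the
    hyperedges of a face the edge vectors add up to zero, because the boundary
    of the face is a closed polygon; what remains is a real number, twice the
    integrated mean curvature, and conjugating a real number by [phi i] gives
    a real number again.  Hence the sum of the transformed hyperedges is real.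

    The combinatorial content lies in [sum_adjacent_faces], which turns the sum
    over adjacent faces into a sum along the boundary cycle of the face, and in
    [sum_edge_vector], where that sum telescopes. *)

Section Quaternions.
Variable R : realType.
Implicit Types (p q : quat R) (a : R).

Fact qim_is_zmod_morphism : {morph @qim R : p q / p - q}.
Proof. by move=> p q; congr Quat; rewrite /= subr0. Qed.

HB.instance Definition _ :=
  GRing.isZmodMorphism.Build (quat R) (quat R) (@qim R) qim_is_zmod_morphism.

Lemma qim_conj_scalar a q : qim (qconj q * a%:A * q) = 0.
Proof. by congr Quat => /=; ring. Qed.

End Quaternions.

Section FaceBoundary.
Variable X : oriented_net.
Implicit Types (d : dart X) (i j : face X).

Lemma lface_iter_succ d k : lface (iter k (@succ X) d) = lface d.
Proof. by symmetry; apply/lface_orbit; exists k. Qed.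

(** The length of the boundary cycle is the least period of [succ]: leastness
    is what makes the darts listed before the first return pairwise distinct. *)
Lemma boundary_cycle d : exists N : nat,
  [/\ iter N (@succ X) d = d,
      set_inj `I_N (fun k => iter k (@succ X) d) &
      forall e, lface e = lface d ->
        exists2 k, (k < N)%N & iter k (@succ X) d = e].
Proof.
pose period m := `[< (0 < m)%N /\ iter m (@succ X) d = d >].
have exP : exists m, period m.
  have /lface_orbit[m mE] : lface (succ d) = lface d.
    exact: (lface_iter_succ d 1).
  by exists m.+1; apply/asboolP; rewrite iterSr.
have [N /asboolP[N_gt0 NE] Nmin] := ex_minnP exP.
have inj a b : (a < b < N)%N ->
    iter a (@succ X) d = iter b (@succ X) d -> False.
  (* Walking on from the repeated dart to the end of the cycle would give the
     shorter period [N - b + a]. *)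
  case/andP=> ab bN abE.
  have /Nmin : period (N - b + a)%N.
    apply/asboolP; split; first by rewrite addn_gt0 subn_gt0 bN.
    by rewrite iterD abE -iterD subnK // ltnW.
  by rewrite leqNgt -{2}(subnK (ltnW bN)) ltn_add2l ab.
exists N; split=> //.
- move=> a b; rewrite !inE /= => aN bN abE.
  case: (ltngtP a b) => // ab; exfalso.
  + by apply: (inj a b) => //; rewrite ab.
  + by apply: (inj b a) => //; rewrite ab.
- move=> e /esym/lface_orbit[m mE]; exists (m %% N)%N; first exact: ltn_pmod.
  have iterMN q : iter (q * N) (@succ X) d = d.
    by elim: q => // q IHq; rewrite mulSn iterD IHq.
  by rewrite -mE {2}(divn_eq m N) addnC iterD iterMN.
Qed.

(** Two faces share at most one edge, so crossing the successive edges of the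
    boundary enumerates the adjacent faces without repetition. *)
Lemma sum_adjacent_faces i : exists (d : dart X) (N : nat),
  [/\ lface d = i, iter N (@succ X) d = d &
      forall (V : nmodType) (F : face X -> V),
        \sum_(j \in adjacent_faces i) F j =
        \sum_(k < N) F (lface (flip (iter k (@succ X) d)))].
Proof.
have [d di] := lface_surj i.
have [N [NE Ninj Nsurj]] := boundary_cycle d.
exists d, N; split=> // V F.
have bij : set_bij `I_N (adjacent_faces i)
    (fun k => lface (flip (iter k (@succ X) d))).
  split.
  - by move=> k _; exists (iter k (@succ X) d); rewrite lface_iter_succ.
  - move=> a b aN bN abE; apply: Ninj => //.
    by apply: common_edge_uniq => //; rewrite !lface_iter_succ.
  - move=> j [e [ei <-]].
    by have [|k kN <-] := Nsurj e; [rewrite ei | exists k].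
by rewrite (reindex_fsbig _ _ _ _ bij) -fsbig_ord.
Qed.

Variables (R : realType) (f : vertex X -> quat R) (n : face X -> quat R).

Lemma edge_vectorE d :
  edge_vector f (lface d) (lface (flip d)) = f (target d) - f (origin d).
Proof.
apply: xget_unique; first by exists d.
by move=> _ [e [le lfe] <-]; rewrite (common_edge_uniq le lfe).
Qed.

Lemma sum_edge_vector i : \sum_(j \in adjacent_faces i) edge_vector f i j = 0.
Proof.
have [d [N [<- NE ->]]] := sum_adjacent_faces i.
under eq_bigr => k _.
  rewrite -(lface_iter_succ d k) edge_vectorE /target -origin_succ -iterS.
  over.
rewrite -(big_mkord xpredT (fun k => f (origin (iter k.+1 (@succ X) d)) -
  f (origin (iter k (@succ X) d)))).
by rewrite telescope_sumr // NE subrr.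
Qed.

Lemma sum_hyperedge i : exists a : R,
  \sum_(j \in adjacent_faces i) hyperedge f n i j = a%:A.
Proof.
have sum0 := sum_edge_vector i.
have [d [N [_ _ sumE]]] := sum_adjacent_faces i.
rewrite sumE in sum0; rewrite sumE big_split /= sum0 addr0 -scaler_suml.
by eexists.
Qed.

End FaceBoundary.

Theorem theorem3p12 (R : realType) (X : oriented_net)
    (f : vertex X -> quat R) (n : face X -> quat R)
    (net : face_edge_constraint_net f n) (sc : simply_connected X)
    (phi : face X -> quat R) (rho : face X -> R)
    (hD : forall i : face X, dirac_operator f n phi i = (rho i)%:A * phi i)
    (i : face X) :
  \sum_(j \in adjacent_faces i) qim (spin_hyperedge f n phi i j) = 0.
Proof.
have [a sumE] := sum_hyperedge X R f n i.
have {hD} := hD i; rewrite /dirac_operator.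
have [d [N [_ _ sum_adj]]] := sum_adjacent_faces X i.
rewrite !sum_adj in sumE *.
under eq_bigr do rewrite mulrBr.
rewrite sumrB -mulr_suml sumE => hD.
rewrite -raddf_sum /=.
under eq_bigr do rewrite /spin_hyperedge -mulrA.
rewrite -mulr_sumr.
(* The eigenvalue equation, solved for the sum of [hyperedge i j * phi j]. *)
move/(congr1 ( *:%R 2)): hD.
rewrite scalerA mulfV ?pnatr_eq0 // scale1r => /eqP.
rewrite subr_eq scalerAl scalerA => /eqP ->.
by rewrite -mulrDl -scalerDl mulrA qim_conj_scalar.
Qed.
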